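(* Let $\theta$ be a real number. A graph $G$ is $\theta$-elementary if and only if $\mathrm{mult}(\theta,G)=0$ and $P_\theta(G\setminus v)\cup N_\theta(G\setminus v)=\varnothing$ for all $v\in V(G)$.
   Context: All graphs are finite and simple. $\mu(G,x)=\sum_{r\ge0}(-1)^r p(G,r)x^{n-2r}$ is the matching polynomial of a graph $G$ on $n$ vertices, where $p(G,r)$ is the number of $r$-matchings ($p(G,0)=1$); $\mathrm{mult}(\theta,G)$ is the multiplicity of $\theta$ as a root of $\mu(G,x)$. $G\setminus v$ denotes deletion of vertex $v$. A vertex $u$ of $H$ is $\theta$-essential if $\mathrm{mult}(\theta,H\setminus u)=\mathrm{mult}(\theta,H)-1$, $\theta$-neutral if $\mathrm{mult}(\theta,H\setminus u)=\mathrm{mult}(\theta,H)$, $\theta$-positive if $\mathrm{mult}(\theta,H\setminus u)=\mathrm{mult}(\theta,H)+1$, and $\theta$-special if it is not $\theta$-essential but is adjacent to a $\theta$-essential vertex. $N_\theta(H)$ is the set of $\theta$-neutral vertices of $H$ and $P_\theta(H)$ is the set of $\theta$-positive vertices of $H$ that are not $\theta$-special. $G$ is $\theta$-super positive if $\mathrm{mult}(\theta,G)=0$ and every vertex of $G$ is $\theta$-positive; $G$ is $\theta$-elementary if it is $\theta$-super positive and $P_\theta(G\setminus v)=\varnothing$ for all $v\in V(G)$.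
   Formalization: The case where G is the one-vertex graph K_1 and θ ≠ 0 is excluded: there mult(θ,G)=0 and P_θ(G\v)∪N_θ(G\v) is empty because G\v has no vertices, yet v is θ-neutral, so G is not θ-elementary. *)

(* Defs.v *)
From HB Require Import structures.
From mathcomp Require Import all_boot all_order all_algebra.
From mathcomp Require Import reals.

Set Implicit Arguments.
Unset Strict Implicit.
Unset Printing Implicit Defensive.

Import Order.TTheory GRing.Theory Num.Theory.

Local Open Scope ring_scope.

(* The vertices form a subset of an ambient finite type [T], so that deleting
   a vertex yields a graph over the same type. *)
Record graph (T : finType) := Graph {
  vertices : {set T};
  edges : {set {set T}};
  edges_subset : forall e, e \in edges -> e \subset vertices;
  edges_card : forall e, e \in edges -> #|e| = 2%N
}.

Section Graphs.
Variable T : finType.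
Implicit Types (G H : graph T) (u v w : T).

Definition adjacent G u v : bool := [set u; v] \in edges G.

Definition del_edges G v : {set {set T}} := [set e in edges G | v \notin e].

Fact del_edges_subset G v e :
  e \in del_edges G v -> e \subset vertices G :\ v.
Proof.
by rewrite inE => /andP[/edges_subset sub_e v_e]; rewrite subsetD1 sub_e.
Qed.

Fact del_edges_card G v e : e \in del_edges G v -> #|e| = 2%N.
Proof. by rewrite inE => /andP[/edges_card]. Qed.

Definition del_vertex G v : graph T :=
  Graph (@del_edges_subset G v) (@del_edges_card G v).

Definition is_matching G (M : {set {set T}}) : bool :=
  (M \subset edges G) && trivIset M.

Definition num_matchings G (r : nat) : nat :=
  #|[set M | is_matching G M & #|M| == r]|.

(* An r-matching covers 2r vertices, so only the terms with r <= n/2 occur;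
   for these the subtraction [n - r.*2] is exact. *)
Definition matching_poly (R : realType) G : {poly R} :=
  \sum_(r < #|vertices G|./2.+1)
     ((-1) ^+ r * (num_matchings G r)%:R) *: 'X^(#|vertices G| - r.*2).

Section Classes.
Variables (R : realType) (theta : R).

Definition mult G : nat := mup theta (matching_poly R G).

(* Written with a successor, as subtraction on [nat] is truncated at 0. *)
Definition essential H u : bool :=
  (u \in vertices H) && ((mult (del_vertex H u)).+1 == mult H).

Definition neutral H u : bool :=
  (u \in vertices H) && (mult (del_vertex H u) == mult H).

Definition positive H u : bool :=
  (u \in vertices H) && (mult (del_vertex H u) == (mult H).+1).

Definition special H u : bool :=
  [&& u \in vertices H, ~~ essential H u
    & [exists w, adjacent H u w && essential H w]].

Definition neutral_set H : {set T} := [set u | neutral H u].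

Definition positive_set H : {set T} := [set u | positive H u && ~~ special H u].

Definition super_positive G : Prop :=
  mult G = 0%N /\ forall v, v \in vertices G -> positive G v.

Definition elementary G : Prop :=
  super_positive G /\
  forall v, v \in vertices G -> positive_set (del_vertex G v) = set0.

End Classes.
End Graphs.

(* Main.v *)
(* Give every vertex i its own variable x + w(i) and let mu_w(S) be the resulting
   matching polynomial of the subgraph induced on S.  Expanding at v in S,
     mu_w(S)/mu_w(S-v) = x + w(v) - \sum_(u ~ v) mu_w(S-v-u)/mu_w(S-v).
   By induction each such quotient is, near any real theta, either regular with
   positive derivative or has a simple pole with negative residue: this class of
   germs contains x + c and is stable under f -> -1/f and under sums.  Hence if
   mu_w(S) does not vanish at theta, theta is at most a simple root of
   mu_w(S-v).  With w = 0 this bounds the multiplicities needed for the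
   converse; with w supported at one vertex u it excludes a neutral vertex u of
   G-v when G is super positive. *)
Require Import Defs.
From mathcomp Require Import all_boot all_order all_algebra.
From mathcomp Require Import reals.
From mathcomp Require Import ring lra.

Set Implicit Arguments.
Unset Strict Implicit.
Unset Printing Implicit Defensive.

Import Order.TTheory GRing.Theory Num.Theory.

Local Open Scope ring_scope.

(** * Germs of rational functions crossing upwards *)

Section Crossing.
Variables (R : realFieldType) (t : R).
Implicit Types p q P Q : {poly R}.

(** Numerator of the derivative of [p / q]; it makes sense even where [q] vanishes, so one
    inequality covers regular points and poles. *)
Definition wronskian p q := p^`() * q - p * q^`().

(* The germ of p / q at t either is regular with positive derivative or has a
   simple pole with negative residue. *)
Definition crosses_up p q := exists m P Q,
  [/\ p = ('X - t%:P) ^+ m * P, q = ('X - t%:P) ^+ m * Q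
    & 0 < (wronskian P Q).[t]].

Lemma crosses_up_inv p q : crosses_up p q -> crosses_up (- q) p.
Proof.
move=> [m [P [Q [-> -> W]]]]; exists m, (- Q), P; rewrite mulrN; split=> //.
by move: W; rewrite /wronskian derivN !hornerE; lra.
Qed.

Lemma crosses_up_neq0 p q : crosses_up p q -> p != 0.
Proof.
move=> [m [P [Q [-> _ W]]]]; rewrite mulf_neq0 ?expf_neq0 ?polyXsubC_eq0 //.
by apply: contraTneq W => ->; rewrite /wronskian deriv0 !mul0r
  subrr horner0 ltxx.
Qed.

Lemma crosses_up_mulX_addC q c : q != 0 -> crosses_up (('X + c%:P) * q) q.
Proof.
move=> q0; have [m [Q /implyP/(_ q0) tQ ->]] := multiplicity_XsubC q t.
exists m, (('X + c%:P) * Q), Q; split; [by ring | by ring |].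
rewrite /wronskian !derivE.
have -> : (1 + 0) * Q + ('X + c%:P) * Q^`() = Q + ('X + c%:P) * Q^`() by ring.
have -> : (Q + ('X + c%:P) * Q^`()) * Q - ('X + c%:P) * Q * Q^`() = Q ^+ 2.
  by ring.
by rewrite horner_exp exprn_even_gt0.
Qed.

Lemma wronskian_mul r p q : wronskian (r * p) (r * q) = r ^+ 2 * wronskian p q.
Proof. by rewrite /wronskian !derivM; ring. Qed.

Lemma wronskianDl p1 p2 q :
  wronskian (p1 + p2) q = wronskian p1 q + wronskian p2 q.
Proof. by rewrite /wronskian derivD; ring. Qed.

Lemma crosses_upD p1 p2 q :
  crosses_up p1 q -> crosses_up p2 q -> crosses_up (p1 + p2) q.
Proof.
move=> [m1 [P1 [Q1 [-> q1 W1]]]] [m2 [P2 [Q2 [-> q2 W2]]]].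
wlog le_m : m1 m2 P1 P2 Q1 Q2 q1 q2 W1 W2 / (m1 <= m2)%N => [IH|].
  case/orP: (leq_total m1 m2) => le_m; first exact: IH q1 q2 W1 W2 le_m.
  by rewrite addrC; apply: IH q2 q1 W2 W1 le_m.
set Y := 'X - t%:P in q1 q2 *.
have Q12 : Q1 = Y ^+ (m2 - m1) * Q2.
  apply: (@mulfI _ (Y ^+ m1)); first by rewrite expf_neq0 ?polyXsubC_eq0.
  by rewrite -q1 mulrA -exprD subnKC.
exists m1, (P1 + Y ^+ (m2 - m1) * P2), Q1; split=> //.
  by rewrite mulrDr mulrA -exprD subnKC.
(* The second Wronskian gains the square of a power of [Y], possibly zero at [t] but never negative;
   the first keeps the sum positive. *)
rewrite wronskianDl hornerD ltr_wpDr // Q12 wronskian_mul hornerM horner_exp.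
by rewrite mulr_ge0 ?sqr_ge0 // ltW.
Qed.

(** Nonvanishing of [p] forces [m = 0]; where [q] vanishes, the Wronskian is then minus [p] times
    the derivative of [q]. *)
Lemma crosses_up_simple_zero p q :
  crosses_up p q -> p.[t] != 0 -> q.[t] = 0 -> q^`().[t] != 0.
Proof.
move=> [[|m] [P [Q [-> -> W]]]]; last first.
  by rewrite !hornerE subrr exprS !mul0r eqxx.
rewrite expr0 !mul1r => P0 Q0; apply: contraTneq W => Q'0.
by rewrite /wronskian !hornerE Q0 Q'0 !mulr0 subrr ltxx.
Qed.

End Crossing.

(** * Multiplicities 0 and 1 of a root *)

Section Multiplicity.
Variables (R : realFieldType) (t : R).
Implicit Type p : {poly R}.

Lemma mup_eq0 p : p != 0 -> (mup t p == 0%N) = (p.[t] != 0).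
Proof. by move=> p0; rewrite -leqn0 mup_leq // expr1 dvdp_XsubCl. Qed.

Lemma mup_eq1 p :
  p != 0 -> (mup t p == 1%N) = (p.[t] == 0) && (p^`().[t] != 0).
Proof.
move=> p0; rewrite eqn_leq mup_leq // lt0n mup_eq0 // negbK andbC.
case: eqP => //= /eqP pt0.
have [q def_p] := factor_theorem _ _ pt0.
have q0 : q != 0 by apply: contraNneq p0 => q0; rewrite def_p q0 mul0r.
rewrite def_p derivM derivXsubC !hornerE subrr mulr0 add0r.
by rewrite expr2 dvdp_mul2r ?polyXsubC_eq0 // dvdp_XsubCl.
Qed.

End Multiplicity.

(** * Vertex-weighted matching polynomials *)

Section WeightedMatching.
Variables (R : realType) (T : finType).
Implicit Types (G : graph T) (w : T -> R) (S : {set T}) (M : {set {set T}}).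

(** [G] stays fixed while [S] varies, so that deleting vertices is mere set difference. *)
Definition weighted_matching_poly G w S : {poly R} :=
  \sum_(M | is_matching G M && (cover M \subset S))
     (-1) ^+ #|M| * \prod_(i in S :\: cover M) ('X + (w i)%:P).

Lemma cover_setU1 (e : {set T}) M : cover (e |: M) = e :|: cover M.
Proof. by rewrite /cover bigcup_setU big_set1. Qed.

(** Removing [e] is a bijection onto the matchings inside [S :\: e]; losing one edge flips the
    sign. *)
Lemma weighted_matching_poly_edge G w S e :
    e \in edges G -> e \subset S ->
  \sum_(M | [&& is_matching G M, cover M \subset S & e \in M])
     (-1) ^+ #|M| * \prod_(i in S :\: cover M) ('X + (w i)%:P)
  = - weighted_matching_poly G w (S :\: e).
Proof.
move=> eG eS.
rewrite (reindex_onto (fun M => e |: M) (fun M => M :\ e)) /=; last first.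
  by move=> M /and3P[_ _ eM]; rewrite setD1K.
have e0 : e != set0 by rewrite -card_gt0 (edges_card eG).
have e_notin M : cover M \subset S :\: e -> e \notin M.
  move=> sM; apply/negP => eM; case/set0Pn: e0 => x xe.
  have /(subsetP sM) : x \in cover M by apply/bigcupP; exists e.
  by rewrite inE xe.
rewrite /weighted_matching_poly -sumrN; apply: eq_big => [M | M].
  rewrite setU11 andbT /is_matching subUset sub1set eG cover_setU1 /=.
  apply/idP/idP.
    move=> /andP[/andP[/andP[MG tr]] sS /eqP eM].
    rewrite MG (trivIsetS _ tr) ?subsetUr //= -eM coverD1 ?setU11 // setSD //.
    by rewrite cover_setU1.
  move=> /andP[/andP[MG tr] sS]; rewrite MG setU1K ?e_notin // eqxx !andbT /=.
  have /andP[sMS dMe] : (cover M \subset S) && [disjoint cover M & e].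
    by rewrite -subsetD.
  rewrite subUset eS sMS andbT trivIsetU ?trivIset1 //.
  by rewrite cover1 disjoint_sym.
move=> /andP[/and3P[_ sS _] /eqP eM].
have eNM : e \notin M by rewrite -eM !inE eqxx.
rewrite cardsU1 eNM add1n exprS mulN1r mulNr cover_setU1; congr (- (_ * _)).
by rewrite setDDl.
Qed.

Lemma weighted_matching_poly_rec G w S v : v \in S ->
  weighted_matching_poly G w S
  = ('X + (w v)%:P) * weighted_matching_poly G w (S :\ v)
    - \sum_(e in edges G | (v \in e) && (e \subset S))
         weighted_matching_poly G w (S :\: e).
Proof.
move=> vS.
(* Matchings missing [v] give the linear term; the others are grouped by the edge [pblock M v]
   covering [v]. *)
rewrite {1}/weighted_matching_poly (bigID (fun M => v \in cover M)) /=.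
rewrite addrC; congr (_ + _).
  rewrite /weighted_matching_poly big_distrr /=; apply: eq_big => [M | M].
    by rewrite subsetD1 andbA.
  move=> /andP[_ vM]; rewrite mulrCA; congr (_ * _).
  rewrite (big_setD1 v) ?inE ?vM //=; congr (_ * _); apply: eq_bigl => i.
  by rewrite !inE; do !case: (_ \in _); case: (_ == _).
rewrite (partition_big (fun M => pblock M v)
  (fun e => (e \in edges G) && ((v \in e) && (e \subset S)))) /=; last first.
  move=> M /andP[/andP[/andP[MG tr] sS] vM].
  rewrite mem_pblock vM (subsetP MG) ?pblock_mem //=.
  apply: subset_trans sS; apply: (bigcup_sup (pblock M v) (F := id)).
  by rewrite pblock_mem.
rewrite -sumrN; apply: eq_bigr => e /and3P[eG ve eS].
rewrite -weighted_matching_poly_edge //; apply: eq_bigl => M.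
apply/andP/and3P=> [[/andP[/andP[mM sS] vM] /eqP <-]|[mM sS eM]].
  by rewrite pblock_mem.
have vM : v \in cover M by apply/bigcupP; exists e.
by case/andP: (mM) => _ tr; rewrite mM sS vM (def_pblock tr eM).
Qed.

Lemma weighted_matching_poly0 G w : weighted_matching_poly G w set0 = 1.
Proof.
rewrite /weighted_matching_poly (big_pred1 set0) => [|M].
  by rewrite cards0 expr0 mul1r set0D big_set0.
apply/andP/eqP => [[/andP[MG _]]|->]; last first.
  by rewrite /is_matching /trivIset /cover !big_set0 !sub0set cards0.
rewrite subset0 => /eqP cM; apply/setP => e; rewrite in_set0.
apply: contra_eqF cM => eM; rewrite -card_gt0.
have /subset_leq_card := bigcup_sup (F := id) e eM.
by apply: leq_trans; rewrite (edges_card (subsetP MG _ eM)).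
Qed.

Lemma crosses_up_weighted_matching G w t S v : v \in S ->
  crosses_up t (weighted_matching_poly G w S)
               (weighted_matching_poly G w (S :\ v)).
Proof.
have [n] := ubnP #|S|; elim: n S v => // n IHn S v leS vS.
have ltS : (#|S :\ v| < n)%N by move: leS; rewrite (cardsD1 v S) vS.
have nz : weighted_matching_poly G w (S :\ v) != 0.
  have [->|[u uS]] := set_0Vmem (S :\ v).
    by rewrite weighted_matching_poly0 oner_eq0.
  exact: crosses_up_neq0 (IHn _ u ltS uS).
rewrite (weighted_matching_poly_rec G w vS) -sumrN.
apply: (big_rec (fun s => crosses_up t (_ + s) _))
  => [|e s /and3P[eG ve eS] cs].
  by rewrite addr0; apply: crosses_up_mulX_addC.
(* The term of an edge [[set v; u]] is -1/f, with f the quotient for [S :\ v] at [u]. *)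
rewrite addrCA addrC; apply: crosses_upD => //; apply: crosses_up_inv.
have /eqP/cards2P [x [y [xy def_e]]] := edges_card eG.
have [u [uv def_u]] : exists u, u != v /\ e = [set v; u].
  move: ve; rewrite def_e !inE => /orP[/eqP->|/eqP->].
    by exists y; rewrite eq_sym.
  by exists x; rewrite setUC.
have uS : u \in S :\ v.
  by rewrite 2!inE uv (subsetP eS) // def_u !inE eqxx orbT.
by rewrite def_u -setDDl; apply: IHn.
Qed.

Lemma eq_weighted_matching_poly G w1 w2 S :
    {in S, w1 =1 w2} ->
  weighted_matching_poly G w1 S = weighted_matching_poly G w2 S.
Proof.
move=> eq_w; apply: eq_bigr => M _; congr (_ * _).
by apply: eq_bigr => i /setDP[/eq_w->].
Qed.

Lemma weighted_matching_poly_del G w S v : v \notin S ->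
  weighted_matching_poly (del_vertex G v) w S = weighted_matching_poly G w S.
Proof.
move=> vS; apply: eq_bigl => M; rewrite /is_matching -!andbA.
apply/and3P/and3P => -[MG tr cS]; split=> //; apply/subsetP => e eM.
  by move/subsetP/(_ e eM): MG; rewrite inE => /andP[].
rewrite inE (subsetP MG) //=; apply: contra vS => ve.
by apply: (subsetP cS); apply/bigcupP; exists e.
Qed.

(** In the expansion at [u], only the linear factor depends on the weight of [u]. *)
Lemma weighted_matching_poly_shift G w s S u : u \in S ->
  weighted_matching_poly G (fun i => w i + (i == u)%:R * s) S
  = weighted_matching_poly G w S + s *: weighted_matching_poly G w (S :\ u).
Proof.
move=> uS; rewrite !(weighted_matching_poly_rec _ _ uS) eqxx mul1r.
have eq_w S' : u \notin S' ->
    weighted_matching_poly G (fun i => w i + (i == u)%:R * s) S'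
    = weighted_matching_poly G w S'.
  move=> uS'; apply: eq_weighted_matching_poly => i iS'.
  by rewrite (negbTE (memPn uS' i iS')) mul0r addr0.
rewrite eq_w ?setD11 // polyCD -mul_polyC addrAC -mulrDl addrA.
congr (_ - _); apply: eq_bigr => e /and3P[_ ue _].
by rewrite eq_w // inE ue.
Qed.

Lemma card_cover_matching G M : is_matching G M -> #|cover M| = #|M|.*2.
Proof.
case/andP=> /subsetP MG /eqnP <-.
rewrite -muln2 -sum_nat_const; apply: eq_bigr => e /MG; exact: edges_card.
Qed.

Lemma matching_polyE G :
  matching_poly R G = weighted_matching_poly G (fun=> 0) (vertices G).
Proof.
have coverV M : is_matching G M -> cover M \subset vertices G.
  case/andP=> /subsetP MG _; apply/bigcupsP => e /MG; exact: edges_subset.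
rewrite /weighted_matching_poly (partition_big
  (fun M => inord #|M| : 'I_(#|vertices G|./2.+1)) xpredT) //=.
apply: eq_bigr => r _; rewrite -mul_polyC polyCM polyC_exp polyCN polyC1.
pose F M := (-1) ^+ r * 'X^(#|vertices G| - r.*2) : {poly R}.
(* This bound ensures that [inord] preserves the size of a matching. *)
have half_card M : is_matching G M -> (#|M| < #|vertices G|./2.+1)%N.
  move=> mM; rewrite ltnS -[#|M|]doubleK half_leq // -(card_cover_matching mM).
  exact: subset_leq_card (coverV M mM).
rewrite (eq_big (mem [set M | is_matching G M & #|M| == r]) F) => [|M|M].
- by rewrite sumr_const /F -/(num_matchings G r) mulrAC polyCMn mulr_natr.
- rewrite /= inE; case mM: (is_matching G M) => //=.
  by rewrite (coverV M mM) /= -val_eqE /= inordK ?half_card.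
- case/andP=> /andP[mM sM] /eqP def_r; rewrite /F -def_r inordK ?half_card //.
  congr (_ * _); rewrite (eq_bigr (fun=> 'X)) => [|i _].
    by rewrite prodr_const cardsD (setIidPr sM) (card_cover_matching mM).
  by rewrite polyC0 addr0.
Qed.

End WeightedMatching.

(** * Multiplicities under vertex deletion *)

Section Multiplicities.
Variables (R : realType) (theta : R) (T : finType).
Implicit Types (G : graph T) (S : {set T}) (u v : T).

Lemma weighted_matching_poly_neq0 G (w : T -> R) S :
  weighted_matching_poly G w S != 0.
Proof.
have [->|[u uS]] := set_0Vmem S.
  by rewrite weighted_matching_poly0 oner_eq0.
exact: crosses_up_neq0 (crosses_up_weighted_matching G w 0 uS).
Qed.

Local Notation mu G S := (weighted_matching_poly G (fun=> 0 : R) S).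

Lemma matching_poly_del G v :
  matching_poly R (del_vertex G v) = mu G (vertices G :\ v).
Proof. by rewrite matching_polyE weighted_matching_poly_del // setD11. Qed.

Lemma matching_poly_del2 G v u :
  matching_poly R (del_vertex (del_vertex G v) u)
  = mu G (vertices G :\ v :\ u).
Proof.
rewrite matching_poly_del weighted_matching_poly_del //.
by rewrite !inE eqxx !(andbF, andFb).
Qed.

Lemma matching_poly_neq0 G : matching_poly R G != 0.
Proof. by rewrite matching_polyE weighted_matching_poly_neq0. Qed.

Lemma mult_eq0 G : (mult theta G == 0%N) = ((matching_poly R G).[theta] != 0).
Proof. by rewrite /mult mup_eq0 ?matching_poly_neq0. Qed.

Lemma mult_eq1 G : (mult theta G == 1%N) =
  ((matching_poly R G).[theta] == 0) && ((matching_poly R G)^`().[theta] != 0).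
Proof. by rewrite /mult mup_eq1 ?matching_poly_neq0. Qed.

Lemma mult_del_vertex G v : v \in vertices G -> mult theta G = 0%N ->
  mult theta (del_vertex G v) = 0%N \/ mult theta (del_vertex G v) = 1%N.
Proof.
move=> vG /eqP; rewrite mult_eq0 matching_polyE => p0.
(* As mu(G) does not vanish at [theta], any zero of mu(G - v) there is simple. *)
have cr := crosses_up_weighted_matching G (fun=> 0) theta vG.
have [] := boolP (mult theta (del_vertex G v) == 0%N); first by left; apply/eqP.
rewrite mult_eq0 negbK matching_poly_del => /eqP q0; right; apply/eqP.
by rewrite mult_eq1 matching_poly_del q0 eqxx (crosses_up_simple_zero cr).
Qed.

(* If u were neutral in G - v, then G - u, G - v and G - u - v would all have
   theta as a simple root. Shifting the variable of u by s replaces mu(G) and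
   mu(G - v) by mu(G) + s mu(G - u) and mu(G - v) + s mu(G - u - v); a suitable
   s makes theta a double root of the latter, although it is not a root of the
   former. *)
Lemma super_positive_not_neutral G v u :
  super_positive theta G -> v \in vertices G ->
  ~~ neutral theta (del_vertex G v) u.
Proof.
move=> [G0 Gpos] vG; apply/negP => /andP[/=]; rewrite !inE => /andP[uv uG].
have mult1 x : x \in vertices G -> mult theta (del_vertex G x) = 1%N.
  by move=> /Gpos/andP[_ /eqP]; rewrite G0.
rewrite (mult1 v vG) mult_eq1 matching_poly_del2 => /andP[/eqP q0 q'0].
move/eqP: (mult1 v vG); rewrite mult_eq1 matching_poly_del => /andP[/eqP v0 _].
move/eqP: (mult1 u uG); rewrite mult_eq1 matching_poly_del => /andP[/eqP u0 _].
move/eqP: G0; rewrite mult_eq0 matching_polyE => p0.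
pose s := - (mu G (vertices G :\ v))^`().[theta]
          / (mu G (vertices G :\ v :\ u))^`().[theta].
have := crosses_up_weighted_matching G (fun i => 0 + (i == u)%:R * s) theta vG.
rewrite !weighted_matching_poly_shift ?inE ?uv // => /crosses_up_simple_zero.
rewrite derivD derivZ !hornerE u0 v0 q0 !mulr0 !addr0 => /(_ p0 erefl).
by rewrite /s mulfVK // subrr eqxx.
Qed.

End Multiplicities.

(* For G = K_1 and theta <> 0 the right-hand side holds, because K_1 minus its
   vertex is empty, but that vertex is theta-neutral, so K_1 is not
   theta-elementary.  The hypothesis [hK1] excludes exactly these cases. *)
Theorem theorem3p2 (R : realType) (theta : R) (T : finType) (G : graph T)
  (hK1 : #|vertices G| = 1%N -> theta = 0%R) :
  elementary theta G <->
  (mult theta G = 0%N /\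
   forall v : T, v \in vertices G ->
     positive_set theta (del_vertex G v)
       :|: neutral_set theta (del_vertex G v) = set0).
Proof.
split=> [[spG posG]|[G0 PN0]].
  split=> [|v vG]; first by case: spG.
  rewrite posG // set0U; apply/setP => u; rewrite !inE.
  exact/negbTE/super_positive_not_neutral.
split; last first.
  by move=> v /PN0 /eqP; rewrite setU_eq0 => /andP[/eqP].
split=> // v vG; rewrite /positive vG G0 /=.
have [Gv0|->] := mult_del_vertex vG G0; last by [].
(* Multiplicity 0 cannot drop, so no vertex is essential and none is special. *)
have noess w : ~~ essential theta (del_vertex G v) w.
  by rewrite /essential Gv0 andbF.
(* If [v] is the only vertex, the polynomial is ['X], and [theta = 0] contradicts [G0]. *)
have [S0|[u uS]] := set_0Vmem (vertices (del_vertex G v)).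
  have VG : vertices G = [set v] by rewrite -(setD1K vG) [_ :\ _]S0 setU0.
  have theta0 : theta = 0 by rewrite hK1 // VG cards1.
  move/eqP: G0; rewrite mult_eq0 matching_polyE.
  rewrite (weighted_matching_poly_rec _ _ vG).
  rewrite big1 => [|e /and3P[/edges_card e2 _]].
    by rewrite theta0 subr0 !hornerE eqxx.
  by move=> /subset_leq_card; rewrite e2 VG cards1.
(* Otherwise [u] is neutral, or positive and not special, against [PN0]. *)
have /setP/(_ u) := PN0 v vG; rewrite !inE /positive /neutral /special uS.
rewrite noess Gv0 /= => /negbT; rewrite negb_or => /andP[pos neu].
have [Gvu|Gvu] := mult_del_vertex uS Gv0; first by rewrite Gvu in neu.
move: pos; rewrite Gvu /= negbK => /existsP[w /andP[_]].
by rewrite (negbTE (noess w)).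
Qed.
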